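(* Let $\mu\in(0,1/2]$, and for small $m_3>0$ put $m_2=\mu$, $m_1=1-\mu-m_3$. Let $H_{m_3}(x,y,z,p_x,p_y,p_z)$ be the Hamiltonian of the restricted four-body problem with primaries of masses $m_1,m_2,m_3$ at the positions $(x_i,y_i,0)$ given in the context. Translate the origin to the primary $m_3$ and apply the symplectic scaling with multiplier $m_3^{-2/3}$, discarding an additive constant, i.e. set $$\widehat H_{m_3}(x,y,z,p_x,p_y,p_z)=m_3^{-2/3}\Big[H_{m_3}\big(m_3^{1/3}x+x_3,\;m_3^{1/3}y+y_3,\;m_3^{1/3}z,\;m_3^{1/3}p_x-y_3,\;m_3^{1/3}p_y+x_3,\;m_3^{1/3}p_z\big)-c_{m_3}\Big],$$ where $c_{m_3}=-\tfrac12(x_3^2+y_3^2)-\frac{m_1}{\rho_1}-\frac{m_2}{\rho_2}$ and $\rho_i=\sqrt{(x_3-x_i)^2+(y_3-y_i)^2}$ for $i=1,2$. Then for every $(x,y,z)\in\mathbb{R}^3\setminus\{0\}$ and every $(p_x,p_y,p_z)\in\mathbb{R}^3$ the limit of $\widehat H_{m_3}(x,y,z,p_x,p_y,p_z)$ as $m_3\to0^+$ exists and equals $$H=\frac12(p_x^2+p_y^2+p_z^2)+yp_x-xp_y+\frac18x^2-\frac{3\sqrt3}{4}(1-2\mu)xy-\frac58y^2+\frac12z^2-\frac{1}{\sqrt{x^2+y^2+z^2}}.$$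
   Context: Restricted four-body problem (R4BP): three primaries of masses $m_1,m_2,m_3>0$ with $m_1+m_2+m_3=1$ move in circular orbits about their center of mass in an equilateral triangle configuration; a massless particle moves under their gravitational attraction. In synodic (rotating) dimensionless coordinates the Hamiltonian of the massless particle is $$H_{m_3}=\frac12(p_x^2+p_y^2+p_z^2)+yp_x-xp_y-\frac{m_1}{r_1}-\frac{m_2}{r_2}-\frac{m_3}{r_3},\qquad r_i=\sqrt{(x-x_i)^2+(y-y_i)^2+z^2}.$$ With $K=m_2(m_3-m_2)+m_1(m_2+2m_3)$ (which is positive for $\mu\in(0,1/2]$ and small $m_3>0$), the primaries are located in the plane $z=0$ at $$x_1=\frac{-|K|\sqrt{m_2^2+m_2m_3+m_3^2}}{K},\quad y_1=0,$$ $$x_2=\frac{|K|[(m_2-m_3)m_3+m_1(2m_2+m_3)]}{2K\sqrt{m_2^2+m_2m_3+m_3^2}},\quad y_2=\frac{-\sqrt3\,m_3}{2m_2^{3/2}}\sqrt{\frac{m_2^3}{m_2^2+m_2m_3+m_3^2}},$$ $$x_3=\frac{|K|}{2\sqrt{m_2^2+m_2m_3+m_3^2}},\quad y_3=\frac{\sqrt3}{2\sqrt{m_2}}\sqrt{\frac{m_2^3}{m_2^2+m_2m_3+m_3^2}}.$$ *)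

(* Defs.v *)
From Stdlib Require Import Reals.
From Coquelicot Require Import Coquelicot.
Open Scope R_scope.

(* Positions of the three primaries, all in the plane z = 0, as functions of
   the masses m1, m2, m3.  The factors |K| / K are kept unsimplified; they are
   meaningful when K <> 0, in particular when m2 = mu is in (0, 1/2],
   m1 = 1 - mu - m3 and m3 > 0 is small. *)

Definition triangle_K (m1 m2 m3 : R) : R :=
  m2 * (m3 - m2) + m1 * (m2 + 2 * m3).

Definition x1 (m1 m2 m3 : R) : R :=
  - Rabs (triangle_K m1 m2 m3) * sqrt (m2 ^ 2 + m2 * m3 + m3 ^ 2)
  / triangle_K m1 m2 m3.

Definition y1 (m1 m2 m3 : R) : R := 0.

Definition x2 (m1 m2 m3 : R) : R :=
  Rabs (triangle_K m1 m2 m3) * ((m2 - m3) * m3 + m1 * (2 * m2 + m3))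
  / (2 * triangle_K m1 m2 m3 * sqrt (m2 ^ 2 + m2 * m3 + m3 ^ 2)).

Definition y2 (m1 m2 m3 : R) : R :=
  - sqrt 3 * m3 / (2 * Rpower m2 (3 / 2))
  * sqrt (m2 ^ 3 / (m2 ^ 2 + m2 * m3 + m3 ^ 2)).

Definition x3 (m1 m2 m3 : R) : R :=
  Rabs (triangle_K m1 m2 m3) / (2 * sqrt (m2 ^ 2 + m2 * m3 + m3 ^ 2)).

Definition y3 (m1 m2 m3 : R) : R :=
  sqrt 3 / (2 * sqrt m2) * sqrt (m2 ^ 3 / (m2 ^ 2 + m2 * m3 + m3 ^ 2)).

(* Distance from (x, y, z) to the point (a, b, 0). *)
Definition dist_to (a b x y z : R) : R :=
  sqrt ((x - a) ^ 2 + (y - b) ^ 2 + z ^ 2).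

Definition H_R4BP (m1 m2 m3 x y z px py pz : R) : R :=
  / 2 * (px ^ 2 + py ^ 2 + pz ^ 2) + y * px - x * py
  - m1 / dist_to (x1 m1 m2 m3) (y1 m1 m2 m3) x y z
  - m2 / dist_to (x2 m1 m2 m3) (y2 m1 m2 m3) x y z
  - m3 / dist_to (x3 m1 m2 m3) (y3 m1 m2 m3) x y z.

Definition rho1 (m1 m2 m3 : R) : R :=
  sqrt ((x3 m1 m2 m3 - x1 m1 m2 m3) ^ 2 + (y3 m1 m2 m3 - y1 m1 m2 m3) ^ 2).

Definition rho2 (m1 m2 m3 : R) : R :=
  sqrt ((x3 m1 m2 m3 - x2 m1 m2 m3) ^ 2 + (y3 m1 m2 m3 - y2 m1 m2 m3) ^ 2).

Definition c_const (m1 m2 m3 : R) : R :=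
  - / 2 * (x3 m1 m2 m3 ^ 2 + y3 m1 m2 m3 ^ 2)
  - m1 / rho1 m1 m2 m3 - m2 / rho2 m1 m2 m3.

Definition H_scaled (mu m3 x y z px py pz : R) : R :=
  let m1 := 1 - mu - m3 in
  let m2 := mu in
  let s := Rpower m3 (1 / 3) in
  let a := x3 m1 m2 m3 in
  let b := y3 m1 m2 m3 in
  Rpower m3 (- (2 / 3)) *
  (H_R4BP m1 m2 m3
     (s * x + a) (s * y + b) (s * z) (s * px - b) (s * py + a) (s * pz)
   - c_const m1 m2 m3).

Definition H_limit (mu x y z px py pz : R) : R :=
  / 2 * (px ^ 2 + py ^ 2 + pz ^ 2) + y * px - x * py
  + / 8 * x ^ 2 - 3 * sqrt 3 / 4 * (1 - 2 * mu) * x * y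
  - 5 / 8 * y ^ 2 + / 2 * z ^ 2
  - 1 / sqrt (x ^ 2 + y ^ 2 + z ^ 2).

(* Main.v *)
(* With D = m2^2 + m2 m3 + m3^2 the triangle formed by the primaries has all
   sides equal to 1, so rho1 = rho2 = 1.  Put s = m3^(1/3), so that m3 = s^3,
   q = x^2 + y^2 + z^2, and let w_i be the scalar product of (x, y) with the
   vector from the i-th primary to the third one.  Then
   r_i^2 = 1 + 2 s w_i + s^2 q, and 1 - 1 / r_i = s w_i + s^2 P_i exactly, with
   P_i continuous in s and equal to q / 2 - 3 / 2 w_i^2 at s = 0.  The terms of
   order s cancel because the center of mass is at the origin; dividing by s^2
   leaves an expression that is continuous at s = 0. *)

Require Import Defs.
From Stdlib Require Import Reals Lra.
From Coquelicot Require Import Coquelicot.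
Open Scope R_scope.

(** * Closed forms of the positions of the primaries *)

Definition mass_norm (m2 m3 : R) : R := sqrt (m2 ^ 2 + m2 * m3 + m3 ^ 2).

Lemma mass_form_pos (m2 m3 : R) :
  0 < m2 -> 0 <= m3 -> 0 < m2 ^ 2 + m2 * m3 + m3 ^ 2.
Proof. intros; nra. Qed.

Lemma mass_norm_pos (m2 m3 : R) : 0 < m2 -> 0 <= m3 -> 0 < mass_norm m2 m3.
Proof. intros; apply sqrt_lt_R0, mass_form_pos; assumption. Qed.

Lemma mass_norm_sqr (m2 m3 : R) :
  0 < m2 -> 0 <= m3 -> mass_norm m2 m3 ^ 2 = m2 ^ 2 + m2 * m3 + m3 ^ 2.
Proof. intros; apply pow2_sqrt, Rlt_le, mass_form_pos; assumption. Qed.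

Lemma sqrt_cube_div (a b : R) :
  0 < a -> 0 < b -> sqrt (a ^ 3 / b) = a * sqrt a / sqrt b.
Proof.
intros ha hb.
rewrite sqrt_div by (try apply pow_le; lra).
replace (a ^ 3) with (a ^ 2 * a) by ring.
rewrite sqrt_mult, sqrt_pow2 by nra; reflexivity.
Qed.

Lemma Rpower_3_2 (a : R) : 0 < a -> Rpower a (3 / 2) = a * sqrt a.
Proof.
intros ha.
replace (3 / 2) with (1 + / 2) by field.
rewrite Rpower_plus, Rpower_1, Rpower_sqrt by assumption; reflexivity.
Qed.

(** With total mass one, [K = m2 (1 - 2 m2) + 2 m1 m3], and [m2 <= 1 / 2] makes the first term
    nonnegative. This removes the factors [|K| / K]. *)
Lemma triangle_K_pos (m2 m3 : R) :
  0 < m2 <= 1 / 2 -> 0 < m3 < 1 - m2 -> 0 < triangle_K (1 - m2 - m3) m2 m3.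
Proof.
intros h2 h3; unfold triangle_K.
replace (_ + _) with (m2 * (1 - 2 * m2) + 2 * (m3 * (1 - m2 - m3))) by ring.
assert (0 < m3 * (1 - m2 - m3)) by (apply Rmult_lt_0_compat; lra).
nra.
Qed.

Lemma x1_eq (m1 m2 m3 : R) :
  0 < triangle_K m1 m2 m3 -> x1 m1 m2 m3 = - mass_norm m2 m3.
Proof.
intros hK; unfold x1; fold (mass_norm m2 m3).
rewrite Rabs_pos_eq by lra; field; lra.
Qed.

Lemma x2_eq (m1 m2 m3 : R) :
  0 < m2 -> 0 <= m3 -> 0 < triangle_K m1 m2 m3 ->
  x2 m1 m2 m3
  = ((m2 - m3) * m3 + m1 * (2 * m2 + m3)) / (2 * mass_norm m2 m3).
Proof.
intros h2 h3 hK; pose proof (mass_norm_pos m2 m3 h2 h3).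
unfold x2; fold (mass_norm m2 m3).
rewrite Rabs_pos_eq by lra; field; lra.
Qed.

Lemma y2_eq (m1 m2 m3 : R) :
  0 < m2 -> 0 <= m3 ->
  y2 m1 m2 m3 = - sqrt 3 * m3 / (2 * mass_norm m2 m3).
Proof.
intros h2 h3; pose proof (mass_norm_pos m2 m3 h2 h3).
pose proof (sqrt_lt_R0 m2 h2).
unfold y2; rewrite Rpower_3_2, sqrt_cube_div by auto using mass_form_pos.
fold (mass_norm m2 m3); field; lra.
Qed.

Lemma x3_eq (m1 m2 m3 : R) :
  0 < triangle_K m1 m2 m3 ->
  x3 m1 m2 m3 = triangle_K m1 m2 m3 / (2 * mass_norm m2 m3).
Proof. intros hK; unfold x3; rewrite Rabs_pos_eq by lra; reflexivity. Qed.

Lemma y3_eq (m1 m2 m3 : R) :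
  0 < m2 -> 0 <= m3 -> y3 m1 m2 m3 = sqrt 3 * m2 / (2 * mass_norm m2 m3).
Proof.
intros h2 h3; pose proof (mass_norm_pos m2 m3 h2 h3).
pose proof (sqrt_lt_R0 m2 h2).
unfold y3; rewrite sqrt_cube_div by auto using mass_form_pos.
fold (mass_norm m2 m3); field; lra.
Qed.

(** * The equilateral triangle and its center of mass *)

Section Configuration.

Variables m2 m3 : R.
Hypothesis h2 : 0 < m2 <= 1 / 2.
Hypothesis h3 : 0 < m3 < 1 - m2.

Let m1 := 1 - m2 - m3.

Let hK : 0 < triangle_K m1 m2 m3 := triangle_K_pos m2 m3 h2 h3.

Let hn : 0 < mass_norm m2 m3.
Proof. apply mass_norm_pos; lra. Qed.

Let hn2 : mass_norm m2 m3 ^ 2 = m2 ^ 2 + m2 * m3 + m3 ^ 2.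
Proof. apply mass_norm_sqr; lra. Qed.

Let sqrt3_sqr : sqrt 3 ^ 2 = 3.
Proof. apply pow2_sqrt; lra. Qed.

Lemma x3_sub_x1 :
  x3 m1 m2 m3 - x1 m1 m2 m3 = (m2 + 2 * m3) / (2 * mass_norm m2 m3).
Proof.
rewrite x3_eq, x1_eq by assumption.
(* When the masses sum to one, [K + 2 D = m2 + 2 m3], where [D] is the square of [mass_norm]. *)
replace (m2 + 2 * m3)
  with (triangle_K m1 m2 m3 + 2 * mass_norm m2 m3 ^ 2)
  by (rewrite hn2; unfold triangle_K, m1; ring).
field; lra.
Qed.

Lemma x3_sub_x2 :
  x3 m1 m2 m3 - x2 m1 m2 m3 = (m3 - m2) / (2 * mass_norm m2 m3).
Proof.
rewrite x3_eq, x2_eq by lra.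
unfold triangle_K, m1; field; lra.
Qed.

Lemma y3_sub_y1 :
  y3 m1 m2 m3 - y1 m1 m2 m3 = sqrt 3 * m2 / (2 * mass_norm m2 m3).
Proof. rewrite y3_eq by lra; unfold y1; ring. Qed.

Lemma y3_sub_y2 :
  y3 m1 m2 m3 - y2 m1 m2 m3 = sqrt 3 * (m2 + m3) / (2 * mass_norm m2 m3).
Proof. rewrite y3_eq, y2_eq by lra; field; lra. Qed.

(** Since [(m2 + 2 m3)^2 + 3 m2^2 = 4 D], numerator and denominator agree. *)
Lemma side13 :
  (x3 m1 m2 m3 - x1 m1 m2 m3) ^ 2 + (y3 m1 m2 m3 - y1 m1 m2 m3) ^ 2 = 1.
Proof.
rewrite x3_sub_x1, y3_sub_y1.
transitivity (((m2 + 2 * m3) ^ 2 + sqrt 3 ^ 2 * m2 ^ 2)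
              / (4 * mass_norm m2 m3 ^ 2)); [field; lra|].
rewrite sqrt3_sqr, hn2; field; nra.
Qed.

Lemma side23 :
  (x3 m1 m2 m3 - x2 m1 m2 m3) ^ 2 + (y3 m1 m2 m3 - y2 m1 m2 m3) ^ 2 = 1.
Proof.
rewrite x3_sub_x2, y3_sub_y2.
transitivity (((m3 - m2) ^ 2 + sqrt 3 ^ 2 * (m2 + m3) ^ 2)
              / (4 * mass_norm m2 m3 ^ 2)); [field; lra|].
rewrite sqrt3_sqr, hn2; field; nra.
Qed.

(** Equivalent to [m1 x1 + m2 x2 + m3 x3 = 0], in the form that later cancels the terms linear in
    [s]. *)
Lemma center_of_mass_x :
  m1 * (x3 m1 m2 m3 - x1 m1 m2 m3) + m2 * (x3 m1 m2 m3 - x2 m1 m2 m3)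
  = x3 m1 m2 m3.
Proof.
rewrite x3_sub_x1, x3_sub_x2, x3_eq by assumption.
unfold triangle_K, m1; field; lra.
Qed.

Lemma center_of_mass_y :
  m1 * (y3 m1 m2 m3 - y1 m1 m2 m3) + m2 * (y3 m1 m2 m3 - y2 m1 m2 m3)
  = y3 m1 m2 m3.
Proof.
rewrite y3_sub_y1, y3_sub_y2, y3_eq by lra.
unfold m1; field; lra.
Qed.

End Configuration.

(** * Exact expansion of the inverse distances *)

(** The remainder [P_i], with [s^2] already divided out of [u^2 = s^2 (2 w + s q)^2], so that it
    makes sense at [s = 0]. *)
Definition tidal (s w q : R) : R :=
  let r := sqrt (1 + 2 * s * w + s ^ 2 * q) in
  q / 2 - (2 * w + s * q) ^ 2 * (r + 2) / (2 * r * (r + 1) ^ 2).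

(* For [r > 0] and [u = r^2 - 1]:
   [1 - 1 / r = u / 2 - u^2 (r + 2) / (2 r (r + 1)^2)]. *)
Lemma inv_dist_expansion (s w q : R) :
  0 < 1 + 2 * s * w + s ^ 2 * q ->
  1 / sqrt (1 + 2 * s * w + s ^ 2 * q) = 1 - s * w - s ^ 2 * tidal s w q.
Proof.
intros h; unfold tidal; cbv zeta.
pose proof (sqrt_lt_R0 _ h) as hr.
pose proof (pow2_sqrt _ (Rlt_le _ _ h)) as hr2.
set (r := sqrt _) in *.
transitivity (1 - (r ^ 2 - 1) / 2
              + (r ^ 2 - 1) ^ 2 * (r + 2) / (2 * r * (r + 1) ^ 2)).
- field; lra.
- rewrite hr2; field; lra.
Qed.

Lemma dist_to_scaled (a b c d s x y z : R) :
  (a - c) ^ 2 + (b - d) ^ 2 = 1 ->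
  dist_to c d (s * x + a) (s * y + b) (s * z)
  = sqrt (1 + 2 * s * (x * (a - c) + y * (b - d))
          + s ^ 2 * (x ^ 2 + y ^ 2 + z ^ 2)).
Proof. intros h; unfold dist_to; f_equal; rewrite <- h; ring. Qed.

Lemma dist_to_scaled_self (a b s x y z : R) :
  0 <= s ->
  dist_to a b (s * x + a) (s * y + b) (s * z)
  = s * sqrt (x ^ 2 + y ^ 2 + z ^ 2).
Proof.
intros hs; unfold dist_to.
rewrite <- (sqrt_pow2 s hs) at 4.
rewrite <- sqrt_mult_alt by nra.
f_equal; ring.
Qed.

(** * The scaled Hamiltonian without its singular factor *)

Definition w1 (mu m3 x y : R) : R :=
  x * ((mu + 2 * m3) / (2 * mass_norm mu m3))
  + y * (sqrt 3 * mu / (2 * mass_norm mu m3)).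

Definition w2 (mu m3 x y : R) : R :=
  x * ((m3 - mu) / (2 * mass_norm mu m3))
  + y * (sqrt 3 * (mu + m3) / (2 * mass_norm mu m3)).

Definition H_regular (mu x y z px py pz s : R) : R :=
  let q := x ^ 2 + y ^ 2 + z ^ 2 in
  / 2 * (px ^ 2 + py ^ 2 + pz ^ 2) + y * px - x * py
  + (1 - mu - s ^ 3) * tidal s (w1 mu (s ^ 3) x y) q
  + mu * tidal s (w2 mu (s ^ 3) x y) q
  - 1 / sqrt q.

(** The shift leaves [- (a^2 + b^2) / 2 - s (x a + y b)] beside the terms in [s^2]: [c_const]
    removes the constants, and the linear parts of the two potentials cancel the rest. *)
Lemma H_scaled_eq (mu x y z px py pz s : R) :
  0 < mu <= 1 / 2 -> 0 < s -> s ^ 3 < 1 - mu -> (x, y, z) <> (0, 0, 0) ->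
  let q := x ^ 2 + y ^ 2 + z ^ 2 in
  0 < 1 + 2 * s * w1 mu (s ^ 3) x y + s ^ 2 * q ->
  0 < 1 + 2 * s * w2 mu (s ^ 3) x y + s ^ 2 * q ->
  H_scaled mu (s ^ 3) x y z px py pz = H_regular mu x y z px py pz s.
Proof.
intros hmu hs hs3 hxyz q hr1 hr2.
assert (hm3 : 0 < s ^ 3 < 1 - mu) by (split; [apply pow_lt|]; assumption).
assert (hq : 0 < sqrt q).
{ apply sqrt_lt_R0; unfold q.
  destruct (Req_dec x 0) as [hx|hx]; [|nra].
  destruct (Req_dec y 0) as [hy|hy]; [|nra].
  destruct (Req_dec z 0) as [hz|hz]; [|nra].
  now subst. }
assert (hcube : s ^ 3 = Rpower s 3) by (rewrite <- Rpower_pow by lra; f_equal; simpl; lra).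
assert (hroot : Rpower (s ^ 3) (1 / 3) = s).
{ rewrite hcube, Rpower_mult.
  replace (3 * (1 / 3)) with 1 by field; now apply Rpower_1. }
assert (hmult : Rpower (s ^ 3) (- (2 / 3)) = / s ^ 2).
{ rewrite hcube, Rpower_mult.
  replace (3 * - (2 / 3)) with (- INR 2) by (simpl; field).
  now rewrite Rpower_Ropp, Rpower_pow. }
unfold H_scaled, H_R4BP, c_const, rho1, rho2, H_regular; cbv zeta; fold q.
rewrite hroot, hmult.
set (m3 := s ^ 3) in *.
rewrite (side13 mu m3 hmu hm3), (side23 mu m3 hmu hm3), sqrt_1.
rewrite (dist_to_scaled _ _ _ _ _ _ _ _ (side13 mu m3 hmu hm3)).
rewrite (dist_to_scaled _ _ _ _ _ _ _ _ (side23 mu m3 hmu hm3)).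
rewrite dist_to_scaled_self by lra.
fold q.
pose proof (center_of_mass_x mu m3 hmu hm3) as ca.
pose proof (center_of_mass_y mu m3 hmu hm3) as cb.
rewrite (x3_sub_x1 mu m3 hmu hm3), (x3_sub_x2 mu m3 hmu hm3) in *.
rewrite (y3_sub_y1 mu m3 hmu hm3), (y3_sub_y2 mu m3 hmu hm3) in *.
fold (w1 mu m3 x y) (w2 mu m3 x y).
set (a := x3 _ _ _) in *; set (b := y3 _ _ _) in *.
(* The center of mass identities, paired with [(x, y)]. *)
assert (hlin : x * a + y * b
               = (1 - mu - m3) * w1 mu m3 x y + mu * w2 mu m3 x y)
  by (rewrite <- ca, <- cb; unfold w1, w2; ring).
clearbody a b.
assert (e1 := inv_dist_expansion _ _ _ hr1).
assert (e2 := inv_dist_expansion _ _ _ hr2).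
(* Only the quotients by [r_1] and [r_2] are opened, to expose the inverses that [e1] and [e2]
   rewrite. *)
unfold Rdiv at 1 2; unfold Rdiv in e1, e2; rewrite Rmult_1_l in e1, e2.
rewrite e1, e2.
set (t1 := tidal _ _ _); set (t2 := tidal _ (w2 _ _ _ _) _).
(* Grouping by order in [s]; the last term is of order [s^2] because [m3 = s^3]. *)
transitivity
  (/ s ^ 2 *
   (s ^ 2 * (/ 2 * (px ^ 2 + py ^ 2 + pz ^ 2) + y * px - x * py
             + (1 - mu - m3) * t1 + mu * t2)
    - s * (x * a + y * b
           - ((1 - mu - m3) * w1 mu m3 x y + mu * w2 mu m3 x y))
    - m3 / (s * sqrt q))).
- field; split; lra.
- rewrite hlin; unfold m3; field; split; lra.
Qed.

(** * Regularity and value at [s = 0] *)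

Lemma mass_norm_0 (mu : R) : 0 < mu -> mass_norm mu 0 = mu.
Proof.
intros h; unfold mass_norm.
rewrite <- (sqrt_pow2 mu) at 3 by lra; f_equal; ring.
Qed.

(** Differentiability serves to get continuity through [auto_derive]; the side conditions are clear
    because the radicand is 1 at [s = 0]. *)
Lemma ex_derive_tidal (f : R -> R) (q : R) :
  ex_derive f 0 -> ex_derive (fun s => tidal s (f s) q) 0.
Proof.
intros hf; unfold tidal; cbv zeta; auto_derive.
match goal with |- _ /\ _ /\ 0 < ?d /\ _ => replace d with 1 by ring end.
rewrite sqrt_1; repeat split; trivial; lra.
Qed.

Lemma tidal_0 (w q : R) : tidal 0 w q = q / 2 - 3 / 2 * w ^ 2.
Proof.
unfold tidal; cbv zeta.
replace (1 + 2 * 0 * w + 0 ^ 2 * q) with 1 by ring.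
rewrite sqrt_1; field.
Qed.

Lemma ex_derive_div_mass_norm (mu c e : R) :
  0 < mu ->
  ex_derive (fun s => (c + e * s ^ 3) / (2 * mass_norm mu (s ^ 3))) 0.
Proof.
intros h; unfold mass_norm; auto_derive.
match goal with |- 0 < ?d /\ _ => replace d with (mu ^ 2) by ring end.
rewrite sqrt_pow2 by lra; repeat split; nra.
Qed.

Lemma ex_derive_w1 (mu x y : R) :
  0 < mu -> ex_derive (fun s => w1 mu (s ^ 3) x y) 0.
Proof.
intros h.
apply ex_derive_ext with
  (fun s => ((x + sqrt 3 * y) * mu + (2 * x) * s ^ 3)
            / (2 * mass_norm mu (s ^ 3))).
(* The ascription turns an equality in a normed module into one in [R], as [ring] requires. *)
- intros s; unfold w1, Rdiv; refine (_ : _ = _ :> R); ring.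
- now apply ex_derive_div_mass_norm.
Qed.

Lemma ex_derive_w2 (mu x y : R) :
  0 < mu -> ex_derive (fun s => w2 mu (s ^ 3) x y) 0.
Proof.
intros h.
apply ex_derive_ext with
  (fun s => ((sqrt 3 * y - x) * mu + (x + sqrt 3 * y) * s ^ 3)
            / (2 * mass_norm mu (s ^ 3))).
- intros s; unfold w2, Rdiv; refine (_ : _ = _ :> R); ring.
- now apply ex_derive_div_mass_norm.
Qed.

Lemma continuous_H_regular (mu x y z px py pz : R) :
  0 < mu -> continuous (H_regular mu x y z px py pz) 0.
Proof.
intros h; apply (ex_derive_continuous (V := R_NormedModule)).
set (q := x ^ 2 + y ^ 2 + z ^ 2).
set (t1 := fun s => tidal s (w1 mu (s ^ 3) x y) q).
set (t2 := fun s => tidal s (w2 mu (s ^ 3) x y) q).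
assert (h1 : ex_derive t1 0) by now apply ex_derive_tidal, ex_derive_w1.
assert (h2 : ex_derive t2 0) by now apply ex_derive_tidal, ex_derive_w2.
change (ex_derive (fun s : R =>
  / 2 * (px ^ 2 + py ^ 2 + pz ^ 2) + y * px - x * py
  + (1 - mu - s ^ 3) * t1 s + mu * t2 s - 1 / sqrt q) 0).
(* With [t1] and [t2] opaque, [auto_derive] asks for just [h1] and [h2]. *)
clearbody t1 t2; auto_derive; repeat split; assumption.
Qed.

(** The tidal terms sum to [q / 2 - 3 / 2 ((1 - mu) w1^2 + mu w2^2)]; the [x y] terms of the two
    squares have opposite signs, whence the factor [1 - 2 mu]. *)
Lemma H_regular_0 (mu x y z px py pz : R) :
  0 < mu -> H_regular mu x y z px py pz 0 = H_limit mu x y z px py pz.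
Proof.
intros h; unfold H_regular, H_limit; cbv zeta.
rewrite !tidal_0; replace (0 ^ 3) with 0 by ring.
unfold w1, w2; rewrite mass_norm_0 by assumption.
(* As an atom, the Kepler term gives [field] no denominator to check. *)
set (t := 1 / sqrt (_ + _)).
replace (x * ((mu + 2 * 0) / (2 * mu)) + y * (sqrt 3 * mu / (2 * mu)))
  with (x / 2 + sqrt 3 * y / 2) by (field; lra).
replace (x * ((0 - mu) / (2 * mu)) + y * (sqrt 3 * (mu + 0) / (2 * mu)))
  with (sqrt 3 * y / 2 - x / 2) by (field; lra).
replace ((x / 2 + sqrt 3 * y / 2) ^ 2)
  with (x ^ 2 / 4 + sqrt 3 * (x * y) / 2 + sqrt 3 ^ 2 * y ^ 2 / 4) by field.
replace ((sqrt 3 * y / 2 - x / 2) ^ 2)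
  with (x ^ 2 / 4 - sqrt 3 * (x * y) / 2 + sqrt 3 ^ 2 * y ^ 2 / 4) by field.
rewrite pow2_sqrt by lra; field.
Qed.

(** * Passage to the limit *)

Lemma locally_0_pos (f : R -> R) :
  ex_derive f 0 -> 0 < f 0 -> locally 0 (fun s => 0 < f s).
Proof.
intros hf h0.
apply (ex_derive_continuous (V := R_NormedModule)) in hf.
exact (hf _ (open_gt 0 _ h0)).
Qed.

Lemma locally_0_dist_pos (f : R -> R) (q : R) :
  ex_derive f 0 -> locally 0 (fun s => 0 < 1 + 2 * s * f s + s ^ 2 * q).
Proof.
intros hf; apply (locally_0_pos (fun s => 1 + 2 * s * f s + s ^ 2 * q)); [|lra].
auto_derive; repeat split; assumption.
Qed.

Lemma filterlim_Rpower_0_right (a : R) :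
  0 < a -> filterlim (fun t => Rpower t a) (at_right 0) (at_right 0).
Proof.
intros ha P [eps hP].
(* The radius solves [t^a = eps]. *)
exists (mkposreal (Rpower eps (/ a)) (exp_pos _)).
intros t ht ht0; change (ball 0 (Rpower eps (/ a)) t) in ht.
unfold ball in ht; simpl in ht; unfold AbsRing_ball, abs, minus, plus, opp in ht.
simpl in ht; rewrite Ropp_0, Rplus_0_r, Rabs_pos_eq in ht by lra.
apply hP; [|apply exp_pos].
unfold ball; simpl; unfold AbsRing_ball, abs, minus, plus, opp; simpl.
rewrite Ropp_0, Rplus_0_r, Rabs_pos_eq by apply Rlt_le, exp_pos.
replace (pos eps) with (Rpower (Rpower eps (/ a)) a).
- apply Rlt_Rpower_l; lra.
- rewrite Rpower_mult, Rinv_l by lra; apply Rpower_1, cond_pos.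
Qed.

Theorem theorem3p1 (mu : R) (hmu : 0 < mu <= 1 / 2)
    (x y z px py pz : R) (hxyz : (x, y, z) <> (0, 0, 0)) :
  filterlim (fun m3 : R => H_scaled mu m3 x y z px py pz)
    (at_right 0) (locally (H_limit mu x y z px py pz)).
Proof.
assert (hmu0 : 0 < mu) by lra.
set (q := x ^ 2 + y ^ 2 + z ^ 2).
assert (heq : at_right 0 (fun s =>
  H_regular mu x y z px py pz s = H_scaled mu (s ^ 3) x y z px py pz)).
{ assert (l0 : locally 0 (fun s => 0 < 1 - mu - s ^ 3)).
  { apply (locally_0_pos (fun s => 1 - mu - s ^ 3)); [auto_derive; trivial|lra]. }
  assert (l1 := locally_0_dist_pos _ q (ex_derive_w1 mu x y hmu0)).
  assert (l2 := locally_0_dist_pos _ q (ex_derive_w2 mu x y hmu0)).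
  generalize (filter_and _ _ l0 (filter_and _ _ l1 l2)).
  unfold at_right, within; apply filter_imp; intros s [k0 [k1 k2]] hs.
  symmetry; apply H_scaled_eq; try assumption; lra. }
(* Substitution [m3 = s^3] with [s = m3^(1/3)], valid for every [m3 > 0]. *)
apply filterlim_ext_loc with
  (fun m3 => H_scaled mu (Rpower m3 (1 / 3) ^ 3) x y z px py pz).
{ exists (mkposreal 1 Rlt_0_1); intros m3 _ hm3.
  rewrite <- Rpower_pow by apply exp_pos.
  rewrite Rpower_mult; replace (1 / 3 * INR 3) with 1 by (simpl; field).
  now rewrite Rpower_1. }
apply (filterlim_comp _ _ _ (fun m3 => Rpower m3 (1 / 3))
  (fun s => H_scaled mu (s ^ 3) x y z px py pz) _ (at_right 0)).
- apply filterlim_Rpower_0_right; lra.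
- apply (filterlim_ext_loc _ _ heq).
  rewrite <- H_regular_0 by assumption.
  (* Two-sided continuity at 0 restricts to the right-hand limit. *)
  refine (filterlim_filter_le_1 _ (filter_le_within (F := locally 0) _) _).
  now apply continuous_H_regular.
Qed.
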